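(* Let $H$ be a real Hilbert space and let $K\subseteq H$ be a nonempty closed set. Then $K$ is a pointed closed convex cone if and only if the distance function $d(\cdot,K):H\to[0,\infty)$ is an asymmetric seminorm.
   Context: $H$ is a real Hilbert space with norm $\lVert\cdot\rVert$. A closed convex cone is a nonempty closed set $K\subseteq H$ such that $\lambda x+\mu y\in K$ for all $x,y\in K$ and all real $\lambda,\mu\ge 0$. It is pointed if $K\cap(-K)=\{0\}$. For a nonempty set $K\subseteq H$, $d(x,K)=\inf_{y\in K}\lVert x-y\rVert$. A function $q:H\to\mathbb{R}$ is sublinear if $q(\lambda x)=\lambda q(x)$ and $q(x+y)\le q(x)+q(y)$ for all real $\lambda\ge 0$ and all $x,y\in H$. An asymmetric seminorm is a sublinear function $q:H\to[0,\infty)$ such that $q(x)=q(-x)=0$ implies $x=0$. *)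

(* Defs.v *)
From HB Require Import structures.
From mathcomp Require Import all_boot all_order all_algebra.
From mathcomp Require Import all_classical all_reals all_analysis.

Set Implicit Arguments.
Unset Strict Implicit.
Unset Printing Implicit Defensive.

Import Order.TTheory GRing.Theory Num.Theory.
Import numFieldNormedType.Exports.

Local Open Scope classical_set_scope.
Local Open Scope ring_scope.

(* A real Hilbert space is a complete normed module H together with a positive
   definite symmetric bilinear form dot (theta = idfun, as the scalars are real)
   such that induces_norm dot holds. *)
Definition induces_norm (R : realType) (H : normedModType R)
    (dot : {dot H for idfun}) : Prop :=
  forall x : H, `|x| = Num.sqrt (dot x x).

Definition closed_convex_cone (R : realType) (H : normedModType R)
    (K : set H) : Prop :=
  [/\ K !=set0, closed K &
      forall (x y : H) (l m : R),
        K x -> K y -> 0 <= l -> 0 <= m -> K (l *: x + m *: y)].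

Definition pointed_cone (R : realType) (H : normedModType R)
    (K : set H) : Prop :=
  K `&` [set - x | x in K] = [set 0].

(* For K = set0 the value is the conventional inf set0 = 0. *)
Definition dist_set (R : realType) (H : normedModType R)
    (x : H) (K : set H) : R :=
  inf [set `|x - y| | y in K].

Definition sublinear (R : realType) (H : lmodType R) (q : H -> R) : Prop :=
  (forall (l : R) (x : H), 0 <= l -> q (l *: x) = l * q x) /\
  (forall x y : H, q (x + y) <= q x + q y).

Definition asymmetric_seminorm (R : realType) (H : lmodType R)
    (q : H -> R) : Prop :=
  [/\ forall x : H, 0 <= q x, sublinear q &
      forall x : H, q x = 0 -> q (- x) = 0 -> x = 0].

(* Main.v *)
Require Import Defs.
From HB Require Import structures.
From mathcomp Require Import all_boot all_order all_algebra.
From mathcomp Require Import all_classical all_reals all_analysis.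

Import Order.TTheory GRing.Theory Num.Theory.
Import numFieldNormedType.Exports.

Local Open Scope classical_set_scope.
Local Open Scope ring_scope.

(** The bridge between the two sides is that a nonempty closed set is the zero
    set of its distance function ([dist_set_eq0]).

    If the distance function is sublinear, its zero set is stable under
    nonnegative combinations, because d(l x + m y) <= l d(x) + m d(y) = 0;
    definiteness of d says exactly that no nonzero x has both x and -x in this
    zero set, which is pointedness.

    Conversely, let K be a cone stable under sums. Adding approximations of x
    and y in K gives an approximation of x + y in K, whence subadditivity
    ([dist_set_subadd]); scaling an approximation of x gives
    d(l x) <= l d(x), and applying this to 1/l as well turns it into an equality
    ([dist_set_homogeneous]). Definiteness is again pointedness, read through
    the zero set. *)

Section DistSet.
Context {R : realType} {H : normedModType R}.
Implicit Types (x y : H) (K : set H).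

Lemma dist_set_le x {y K} : K y -> dist_set x K <= `|x - y|.
Proof.
move=> Ky; apply: ge_inf; last by exists y.
by exists 0 => _ [z _ <-]; exact: normr_ge0.
Qed.

(** With [dist_set_le], this characterizes the distance as a greatest lower
    bound; it lets the estimates below be proved without choosing points of K
    that are optimal up to an epsilon. *)
Lemma le_dist_set x K (c : R) : K !=set0 ->
  (forall y, K y -> c <= `|x - y|) -> c <= dist_set x K.
Proof.
move=> [y Ky] cle; apply: lb_le_inf; first by exists `|x - y|, y.
by move=> _ [z Kz <-]; exact: cle.
Qed.

Lemma dist_set_ge0 x K : K !=set0 -> 0 <= dist_set x K.
Proof. by move=> K0; apply: le_dist_set => // y _; exact: normr_ge0. Qed.

(** Off K, a whole ball around x misses K because K is closed, and its radius
    is a positive lower bound of the distances to the points of K. *)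
Lemma dist_set_eq0 x {K} : K !=set0 -> closed K ->
  dist_set x K = 0 <-> K x.
Proof.
move=> K0 Kcl; split=> [dx0|Kx]; last first.
  apply/eqP; rewrite eq_le dist_set_ge0 // andbT.
  by have := dist_set_le x Kx; rewrite subrr normr0.
apply: contrapT => nKx.
have /nbhs_ballP[e /= e0 eK] : nbhs x (~` K).
  by apply: open_nbhs_nbhs; split=> //; exact: closed_openC.
suff : e <= dist_set x K by rewrite dx0 leNgt e0.
apply: le_dist_set => // y Ky; rewrite leNgt; apply/negP => xye.
by apply: (eK y) Ky; rewrite -ball_normE.
Qed.

Lemma dist_set_subadd x y K : K !=set0 ->
  (forall a b, K a -> K b -> K (a + b)) ->
  dist_set (x + y) K <= dist_set x K + dist_set y K.
Proof.
move=> K0 KD; rewrite -lerBlDr; apply: le_dist_set => // a Ka.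
rewrite lerBlDr -lerBlDl; apply: le_dist_set => // b Kb.
rewrite lerBlDl (le_trans (dist_set_le _ (KD _ _ Ka Kb))) //.
by rewrite opprD addrACA ler_normD.
Qed.

Lemma dist_set_scale_le (l : R) x K : K !=set0 -> 0 < l ->
  (forall a, K a -> K (l *: a)) ->
  dist_set (l *: x) K <= l * dist_set x K.
Proof.
move=> K0 l0 KZ; rewrite mulrC -ler_pdivrMr //.
apply: le_dist_set => // a Ka.
rewrite ler_pdivrMr // mulrC (le_trans (dist_set_le _ (KZ _ Ka))) //.
by rewrite -scalerBr normrZ gtr0_norm.
Qed.

(** Scaling by l is inverted by scaling by 1/l, under which K is stable too, so
    the one-sided estimate used for both factors gives equality. The factor
    l = 0 has no inverse and is dealt with by the vertex 0 of the cone. *)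
Lemma dist_set_homogeneous (l : R) x K : K !=set0 -> 0 <= l ->
  (forall (m : R) a, 0 <= m -> K a -> K (m *: a)) ->
  dist_set (l *: x) K = l * dist_set x K.
Proof.
move=> K0; rewrite le_eqVlt => /predU1P[<- KZ|l0 KZ].
  have K00 : K 0 by have [a Ka] := K0; rewrite -(scale0r a); exact: KZ.
  rewrite scale0r mul0r; apply/eqP; rewrite eq_le dist_set_ge0 // andbT.
  by have := dist_set_le 0 K00; rewrite subrr normr0.
apply/eqP; rewrite eq_le dist_set_scale_le //=; last first.
  by move=> a; apply: KZ; exact: ltW.
rewrite mulrC -ler_pdivlMr // mulrC -{1}(scalerK (lt0r_neq0 l0) x).
apply: dist_set_scale_le; rewrite ?invr_gt0 // => a.
by apply: KZ; rewrite invr_ge0 ltW.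
Qed.

End DistSet.

Theorem theorem4p6 (R : realType) (H : completeNormedModType R)
    (dot : {dot H for idfun}) (dot_norm : induces_norm dot)
    (K : set H) (K_neq0 : K !=set0) (K_closed : closed K) :
  closed_convex_cone K /\ pointed_cone K <->
  asymmetric_seminorm (fun x : H => dist_set x K).
Proof.
have d0 x : dist_set x K = 0 <-> K x by exact: dist_set_eq0.
split=> [[[_ _ Kcone] Kpt]|[_ [dZ dD] d_def]].
  have KZ (m : R) (a : H) : 0 <= m -> K a -> K (m *: a).
    by move=> m0 Ka; rewrite -[m *: a]addr0 -(scale0r a); exact: Kcone.
  have KD a b : K a -> K b -> K (a + b).
    by move=> Ka Kb; rewrite -(scale1r a) -(scale1r b); apply: Kcone.
  split=> [x||x /d0 Kx /d0 KNx]; first exact: dist_set_ge0.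
    by split=> [l x l0|x y]; [exact: dist_set_homogeneous|exact: dist_set_subadd].
  suff : (K `&` [set - x | x in K]) x by rewrite Kpt.
  by split=> //; exists (- x); rewrite ?opprK.
have K0 : K 0 by apply/d0; rewrite -(scale0r (0 : H)) dZ // mul0r.
split.
  split=> // x y l m /d0 dx0 /d0 dy0 l0 m0; apply/d0.
  apply/eqP; rewrite eq_le dist_set_ge0 // andbT.
  by rewrite (le_trans (dD _ _)) // !dZ // dx0 dy0 !mulr0 addr0.
apply/seteqP; split=> [x [Kx [y Ky yx]]|_ ->].
  by apply: d_def; apply/d0 => //; rewrite -yx opprK.
by split=> //; exists 0; rewrite ?oppr0.
Qed.
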